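(* Let $\alpha=(\alpha_n)_{n\ge 1}$ be a probability measure on the set of positive integers, and for each $n\ge 1$ let $\widetilde\kappa_n$ be a probability measure on $K_n\times K_n$ both of whose marginal distributions are equal to $\kappa_n=\mathrm{Unif}(K_n)$. Let $\widetilde\lambda=\sum_{n\ge1}\alpha_n\widetilde\kappa_n$ (a probability measure on $\Phi\times\Phi$) and let $\widetilde\mu=\delta_{-1}\otimes\widetilde\lambda$ be the corresponding probability measure on the group $\widetilde{\mathcal L}_0=\mathbb Z\ltimes(\Phi\times\Phi)\subset\mathcal L\times\mathcal L$. Suppose that the first moment $\sum_{n\ge1} n\alpha_n$ is infinite, and that the set of indices $n$ with $\alpha_n>0$ for which $\widetilde\kappa_n$ is not the diagonal measure $\operatorname{diag}\kappa_n$ (i.e. for which $\widetilde\kappa_n$ is not concentrated on the diagonal of $K_n\times K_n$) is non-empty and finite. Then the measure $\widetilde\mu$ is non-Liouville, while both coordinate projections of $\widetilde\mu$ onto the two factors $\mathcal L$ of the product $\mathcal L\times\mathcal L$ are Liouville measures on $\mathcal L$.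
   Context: Random walks and the Liouville property. For a probability measure $\mu$ on a countable group $G$ (with identity $e$), the random walk $(G,\mu)$ issued from $e$ is $g_t=h_1h_2\cdots h_t$, $g_0=e$, with $(h_t)$ i.i.d. $\mu$-distributed; let $\mathbf P$ be its law on $G^{\mathbb Z_+}$. The measure $\mu$ is called Liouville if the image of $\mathbf P$ on the Poisson boundary is a point mass, i.e. if every subset of $G^{\mathbb Z_+}$ invariant under the time shift $(g_0,g_1,\dots)\mapsto(g_1,g_2,\dots)$ has $\mathbf P$-measure $0$ or $1$. Equivalently, every bounded function $f$ on the set $S=\bigcup_{t\ge0}\operatorname{supp}\mu^{*t}$ of points attainable from $e$ (with $\mu^{*0}=\delta_e$) satisfying $f(g)=\sum_h\mu(h)f(gh)$ for all $g\in S$ is constant. No irreducibility of $\mu$ is assumed. Non-Liouville means not Liouville. Groups. $\Phi=\bigoplus_{\mathbb Z}\mathbb Z_2$ is the group of finitely supported functions (configurations) $\varphi:\mathbb Z\to\mathbb Z_2=\{0,1\}$ under pointwise addition mod 2, with $\operatorname{supp}\varphi=\varphi^{-1}(1)$. The shifts are $(T^n\varphi)(z)=\varphi(z-n)$. The lamplighter group $\mathcal L=\mathbb Z\wr\mathbb Z_2$ is the set $\mathbb Z\times\Phi$ with multiplication $(n_1,\varphi_1)(n_2,\varphi_2)=(n_1+n_2,\varphi_1+T^{n_1}\varphi_2)$. The group $\widetilde{\mathcal L}_0$ is the set $\mathbb Z\times\Phi\times\Phi$ with multiplication $(n_1,\varphi_1,\varphi_1')(n_2,\varphi_2,\varphi_2')=(n_1+n_2,\varphi_1+T^{n_1}\varphi_2,\varphi_1'+T^{n_1}\varphi_2')$,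 viewed as a subgroup of $\mathcal L\times\mathcal L$ via $(n,\varphi,\varphi')\mapsto((n,\varphi),(n,\varphi'))$; the coordinate projections are $(n,\varphi,\varphi')\mapsto(n,\varphi)$ and $(n,\varphi,\varphi')\mapsto(n,\varphi')$. Sets and measures. For $n\ge1$, $K_n=\{\varphi\in\Phi:\operatorname{supp}\varphi\subset\{0,1,\dots,n\},\ \varphi(n)=1\}$ (so $|K_n|=2^n$), and $\kappa_n=\mathrm{Unif}(K_n)$ is the uniform probability measure on $K_n$. $\operatorname{diag}\kappa_n$ is the image of $\kappa_n$ under $\varphi\mapsto(\varphi,\varphi)$. The measure $\delta_{-1}\otimes\widetilde\lambda$ on $\widetilde{\mathcal L}_0=\mathbb Z\times(\Phi\times\Phi)$ assigns mass $\widetilde\lambda(\varphi,\varphi')$ to $(-1,\varphi,\varphi')$. *)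

(* Defs.v *)
From HB Require Import structures.
From mathcomp Require Import all_boot all_order all_algebra finmap.
From mathcomp Require Import all_classical all_reals all_analysis.

Set Implicit Arguments.
Unset Strict Implicit.
Unset Printing Implicit Defensive.

Import Order.TTheory GRing.Theory Num.Theory.
Local Open Scope classical_set_scope.
Local Open Scope ring_scope.

(* [discr T] is an alias of [T] carrying the sigma-algebra of all subsets, so
   that [probability (discr T) R] is the type of probability measures on the
   discrete space [T].  The base point is only there because the library's
   measurable types are pointed. *)
Definition discr (T : Type) : Type := T.

Section discr.
Variable T : pointedType.
HB.instance Definition _ := Pointed.on (discr T).
HB.instance Definition _ := @isMeasurable.Build default_measure_display
  (discr T) (@discrete_measurable T) (@discrete_measurable0 T)
  (@discrete_measurableC T) (@discrete_measurableU T).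
End discr.

Section image_law.
Context {R : realType} {T T' : pointedType}.

Definition discr_fun (f : T -> T') : discr T -> discr T' := f.

Let measurable_discr_fun f : measurable_fun [set: discr T] (discr_fun f).
Proof. by []. Qed.

HB.instance Definition _ f := isMeasurableFun.Build _ _ _ _
  (discr_fun f) (measurable_discr_fun f).

Definition image_law (f : T -> T') (P : probability (discr T) R)
    : probability (discr T') R := distribution P (discr_fun f).
End image_law.

(* The sum starts at n = 0, so that it is a probability measure for every
   alpha; the 0-th term vanishes when alpha is carried by the positive
   integers. *)
Section mixture.
Local Open Scope ereal_scope.
Context {R : realType} {T : pointedType}.
Variables (alpha : probability nat R) (k : nat -> probability (discr T) R).

Definition mixture (A : set (discr T)) : \bar R :=
  \sum_(0 <= n <oo) alpha [set n] * k n A.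

Let w n : {nonneg R} := NngNum (fine_ge0 (measure_ge0 alpha [set n])).

Let mixtureE : mixture = mseries (fun n => mscale (w n) (k n)) 0.
Proof.
apply/funext => A; apply: eq_eseriesr => n _ /=.
by rewrite /mscale/= fineK// fin_num_measure.
Qed.

Let mixture0 : mixture set0 = 0.
Proof. by rewrite mixtureE measure0. Qed.

Let mixture_ge0 A : 0 <= mixture A.
Proof. by rewrite mixtureE. Qed.

Let mixture_sigma_additive : semi_sigma_additive mixture.
Proof. by rewrite mixtureE; exact: measure_semi_sigma_additive. Qed.

HB.instance Definition _ := isMeasure.Build _ _ _ mixture
  mixture0 mixture_ge0 mixture_sigma_additive.

Let mixtureT : mixture [set: _] = 1.
Proof.
have -> : mixture [set: _] = \sum_(0 <= n <oo) alpha [set n].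
  by apply: eq_eseriesr => n _; rewrite probability_setT mule1.
rewrite -(probability_setT alpha) -measure_semi_bigcup//=.
- by congr (alpha _); apply/seteqP; split => // n _; exists n.
- by apply/trivIsetP => i j _ _ ij; apply/seteqP; split => // x [/= -> /eqP];
     rewrite (negbTE ij).
Qed.

HB.instance Definition _ := Measure_isProbability.Build _ _ _
  mixture mixtureT.
End mixture.

(* Meaningful for K finite and nonempty only: [fset_set] is empty on infinite
   sets. *)
Definition unif {R : realType} {T : pointedType} (K A : set (discr T))
    : \bar R :=
  ((#|` fset_set (K `&` A)|)%:R / (#|` fset_set K|)%:R)%:E.

#[short(type="countGroupType")]
HB.structure Definition CountGroup :=
  {G of Group G & Countable G & isPointed G}.

(* G^{Z_+} with the sigma-algebra generated by the coordinate maps. *)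
Definition paths (G : countGroupType) : Type :=
  g_sigma_algebraType
    [set C : set (nat -> G) | exists t B, C = [set w | B (w t)]].

HB.instance Definition _ (G : countGroupType) := Measurable.on (paths G).

Section random_walk.
Context {R : realType} {G : countGroupType}.
Implicit Types (mu : probability (discr G) R) (P Q : probability (paths G) R).

(* Coordinates are numbered from 0: [h i] is the increment h_{i+1}. *)
Definition iid_law mu Q :=
  forall (n : nat) (A : nat -> set (discr G)),
    Q [set h : paths G | forall i, (i < n)%N -> A i (h i)] =
    (\prod_(i < n) mu (A i))%E.

Definition walk (h : paths G) : paths G := fun t => (\prod_(i < t) h i)%g.

Definition walk_law mu P :=
  exists2 Q, iid_law mu Q &
    forall A : set (paths G), measurable A -> P A = Q (walk @^-1` A).

Definition time_shift (w : paths G) : paths G := fun t => w t.+1.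

(* There is exactly one P with [walk_law mu P], so that "for all P" reads "for
   the law P of the random walk". *)
Definition liouville mu :=
  forall P, walk_law mu P ->
  forall A : set (paths G), measurable A -> time_shift @^-1` A = A ->
    P A = 0%E \/ P A = 1%E.

End random_walk.

Definition conf : Type := {fsfun int -> 'Z_2 with 0}.

HB.instance Definition _ := Countable.on conf.


Section conf_zmod.
Implicit Types phi psi : conf.

Lemma confP phi psi : phi =1 psi <-> phi = psi.
Proof. exact: fsfunP. Qed.

Lemma conf_out phi z : z \notin finsupp phi -> phi z = 0.
Proof. exact: fsfun_dflt. Qed.

Definition conf0 : conf := [fsfun].
Definition conf_opp phi : conf := [fsfun z in finsupp phi => - phi z].
Definition conf_add phi psi : conf :=
  [fsfun z in (finsupp phi `|` finsupp psi)%fset => phi z + psi z].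

Let conf0E z : conf0 z = 0.
Proof. by rewrite fsfunE. Qed.

Let conf_oppE phi z : conf_opp phi z = - phi z.
Proof.
rewrite fsfunE; case: ifPn => // /conf_out ->.
by rewrite oppr0.
Qed.

Let conf_addE phi psi z : conf_add phi psi z = phi z + psi z.
Proof.
rewrite fsfunE; case: ifPn => //.
by rewrite in_fsetU negb_or => /andP[/conf_out -> /conf_out ->]; rewrite addr0.
Qed.

Let conf_addA : associative conf_add.
Proof. by move=> a b c; apply/confP => z; rewrite !conf_addE addrA. Qed.

Let conf_addC : commutative conf_add.
Proof. by move=> a b; apply/confP => z; rewrite !conf_addE addrC. Qed.

Let conf_add0 : left_id conf0 conf_add.
Proof. by move=> a; apply/confP => z; rewrite conf_addE conf0E add0r. Qed.

Let conf_addN : left_inverse conf0 conf_opp conf_add.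
Proof.
by move=> a; apply/confP => z; rewrite conf_addE conf_oppE conf0E addNr.
Qed.

HB.instance Definition _ := GRing.isZmodule.Build conf
  conf_addA conf_addC conf_add0 conf_addN.
HB.instance Definition _ := isPointed.Build conf 0.

Lemma confD phi psi z : (phi + psi) z = phi z + psi z.
Proof. exact: conf_addE. Qed.

Lemma conf0z z : (0 : conf) z = 0.
Proof. exact: conf0E. Qed.

Definition shift (n : int) phi : conf :=
  [fsfun z in [fset (x + n)%R | x in finsupp phi]%fset => phi (z - n)].

Lemma shiftE n phi z : shift n phi z = phi (z - n).
Proof.
rewrite fsfunE; case: ifPn => // hz.
rewrite conf_out//; apply: contra hz => hz.
by apply/imfsetP; apply: (ex_intro2 _ _ (z - n)) => //; rewrite subrK.
Qed.

Lemma shiftD n phi psi : shift n (phi + psi) = shift n phi + shift n psi.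
Proof. by apply/confP => z; rewrite !(confD, shiftE). Qed.

Lemma shift0 n : shift n 0 = 0.
Proof. by apply/confP => z; rewrite shiftE !conf0z. Qed.

Lemma shift_shift m n phi : shift m (shift n phi) = shift (m + n) phi.
Proof. by apply/confP => z; rewrite !shiftE opprD addrA. Qed.

Lemma shift_id phi : shift 0 phi = phi.
Proof. by apply/confP => z; rewrite shiftE subr0. Qed.

Lemma shiftN n phi : shift n (- phi) = - shift n phi.
Proof. by apply/eqP; rewrite -addr_eq0 -shiftD addNr shift0. Qed.

End conf_zmod.

(* The lamplighter group Z wr Z_2.  Being an alias, [lamp] does not inherit the
   componentwise operations of the product type. *)
Definition lamp : Type := (int * conf)%type.
HB.instance Definition _ := Countable.on lamp.

Section lamp_group.
Definition lamp_mul (x y : lamp) : lamp :=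
  (x.1 + y.1, x.2 + shift x.1 y.2).
Definition lamp_one : lamp := (0, 0).
Definition lamp_inv (x : lamp) : lamp := (- x.1, - shift (- x.1) x.2).

Let lamp_mulA : associative lamp_mul.
Proof.
by move=> x y z; rewrite /lamp_mul/= shiftD shift_shift !addrA.
Qed.

Let lamp_mul1g : left_id lamp_one lamp_mul.
Proof. by case=> n phi; rewrite /lamp_mul/= shift_id !add0r. Qed.

Let lamp_mulg1 : right_id lamp_one lamp_mul.
Proof. by case=> n phi; rewrite /lamp_mul/= shift0 !addr0. Qed.

Let lamp_mulVg : left_inverse lamp_one lamp_inv lamp_mul.
Proof. by case=> n phi; rewrite /lamp_mul/= !addNr. Qed.

Let lamp_mulgV : right_inverse lamp_one lamp_inv lamp_mul.
Proof.
by case=> n phi; rewrite /lamp_mul/= shiftN shift_shift !subrr shift_id subrr.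
Qed.

HB.instance Definition _ := isGroup.Build lamp
  lamp_mulA lamp_mul1g lamp_mulg1 lamp_mulVg lamp_mulgV.
HB.instance Definition _ := isPointed.Build lamp lamp_one.
End lamp_group.

(* (n, (phi, phi')) stands for the element ((n, phi), (n, phi')) of
   lamp * lamp. *)
Definition lamp2 : Type := (int * (conf * conf))%type.
HB.instance Definition _ := Countable.on lamp2.

Section lamp2_group.
Definition lamp2_mul (x y : lamp2) : lamp2 :=
  (x.1 + y.1, (x.2.1 + shift x.1 y.2.1, x.2.2 + shift x.1 y.2.2)).
Definition lamp2_one : lamp2 := (0, (0, 0)).
Definition lamp2_inv (x : lamp2) : lamp2 :=
  (- x.1, (- shift (- x.1) x.2.1, - shift (- x.1) x.2.2)).

Let lamp2_mulA : associative lamp2_mul.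
Proof.
by move=> x y z; rewrite /lamp2_mul/= !shiftD !shift_shift !addrA.
Qed.

Let lamp2_mul1g : left_id lamp2_one lamp2_mul.
Proof. by case=> n [phi psi]; rewrite /lamp2_mul/= !shift_id !add0r. Qed.

Let lamp2_mulg1 : right_id lamp2_one lamp2_mul.
Proof. by case=> n [phi psi]; rewrite /lamp2_mul/= !shift0 !addr0. Qed.

Let lamp2_mulVg : left_inverse lamp2_one lamp2_inv lamp2_mul.
Proof. by case=> n [phi psi]; rewrite /lamp2_mul/= !addNr. Qed.

Let lamp2_mulgV : right_inverse lamp2_one lamp2_inv lamp2_mul.
Proof.
case=> n [phi psi]; rewrite /lamp2_mul/=.
by rewrite !shiftN !shift_shift !subrr !shift_id !subrr.
Qed.

HB.instance Definition _ := isGroup.Build lamp2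
  lamp2_mulA lamp2_mul1g lamp2_mulg1 lamp2_mulVg lamp2_mulgV.
HB.instance Definition _ := isPointed.Build lamp2 lamp2_one.
End lamp2_group.

Definition lamp2_fst (x : lamp2) : lamp := (x.1, x.2.1).
Definition lamp2_snd (x : lamp2) : lamp := (x.1, x.2.2).

Definition Kset (n : nat) : set conf :=
  [set phi : conf | (forall z : int, phi z != 0 -> 0 <= z <= n%:Z) /\
                    phi n%:Z = 1].

Section measures.
Context {R : realType}.

Definition kappa (n : nat) : set (discr conf) -> \bar R := unif (Kset n).

Definition diag_kappa (n : nat) : set (discr (conf * conf)%type) -> \bar R :=
  pushforward (kappa n) (discr_fun (fun phi : conf => (phi, phi))).

(* delta_{-1} (x) lambda, as the image of lambda under p |-> (-1, p). *)
Definition down_law (lambda : probability (discr (conf * conf)%type) R)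
    : probability (discr lamp2) R :=
  image_law (fun p : conf * conf => (-1, p) : lamp2) lambda.

End measures.

(* Main.v *)
From HB Require Import structures.
Require Import Defs.
From mathcomp Require Import all_boot all_order all_algebra finmap.
From mathcomp Require Import all_classical all_reals all_analysis.
From mathcomp Require Import zify.

Set Implicit Arguments.
Unset Strict Implicit.
Unset Printing Implicit Defensive.

Import Order.TTheory GRing.Theory Num.Theory.
Local Open Scope classical_set_scope.
Local Open Scope ring_scope.

(** Every increment moves the lamplighter one step to the left, and the i-th
    increment, drawn at position -i from K_n, randomizes the lamps of the window
    [-i, n - i), toggles the lamp n - i and leaves the others alone.

    Each projection is Liouville.  The first moment is infinite, so by the second
    Borel-Cantelli lemma ([iid_never_hit], [tail_sum_late]) the window of some
    increment covers any given finite set of lamps.  Let two starting points have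
    the same position and let delta be the difference of their lamps.  At the
    first time k when the window covers delta, adding delta, shifted by k, to the
    increment drawn at that time couples the two walks from then on.  This
    modification preserves the law of the increments, since a uniform
    configuration of K_n stays uniform when a fixed configuration supported in
    {0, ..., n - 1} is added to it, and since it does not affect the time k
    ([hit_flip]).  Hence the probability of hitting a shift-invariant event,
    conditionally on the first t increments, depends only on the position, which
    is -t.  So the event is independent of the first t increments for every t,
    hence of itself, and has probability 0 or 1 ([liouville_criterion],
    [lamp_liouville]).

    The joint walk is not Liouville.  The two coordinates of an increment differ
    with positive probability, but only through the finitely many n with a
    non-diagonal coupling, hence only in a bounded window.  Let m be the largest
    site at which they differ with positive probability.  The lamps of the two
    walks at the site m are compared in the increment i at the site m + i, where
    for i > 0 they almost surely agree.  The first increment thus decides whether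
    the two walks eventually agree at m, an invariant event.  Its probability is
    less than 1 by the choice of m, and positive because the infinite first moment
    leaves some n of positive mass with a diagonal coupling
    ([nonliouville_criterion], [mut_nonliouville]).  As the Liouville property is
    about all laws of the walk, its failure also takes a sequence of independent
    increments, which is built from the Lebesgue measure on [0, 1)
    ([iid_exists]). *)

(* The shift of configurations, not the translation of a normed module. *)
Local Notation shift := Defs.shift.

(** * Comparing measures through countable partitions *)

Section trace_image.
Local Open Scope ereal_scope.
Context d d' (T : measurableType d) (T' : measurableType d') (R : realType).
Variables (m : {measure set T -> \bar R}) (C : set T) (f : T -> T').

(** The two measurability proofs are arguments so that the measure structure can
    be inferred. *)
Definition trace_image (mC : measurable C) (mf : measurable_fun [set: T] f)
    (B : set T') : \bar R := m (f @^-1` B `&` C).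

Variables (mC : measurable C) (mf : measurable_fun [set: T] f).

Let mpre B : measurable B -> measurable (f @^-1` B).
Proof. by move=> mB; rewrite -[X in measurable X]setTI; exact: mf. Qed.

Let trace_image0 : trace_image mC mf set0 = 0.
Proof. by rewrite /trace_image preimage_set0 set0I measure0. Qed.

Let trace_image_ge0 B : 0 <= trace_image mC mf B.
Proof. exact: measure_ge0. Qed.

Let trace_image_sigma_additive : semi_sigma_additive (trace_image mC mf).
Proof.
move=> F mF tF mUF; rewrite /trace_image preimage_bigcup setI_bigcupl.
apply: measure_semi_sigma_additive.
- by move=> n; apply: measurableI => //; exact: mpre.
- apply/trivIsetP => /= i j _ _ ij; rewrite setIACA -preimage_setI.
  by move/trivIsetP : tF => /(_ _ _ _ _ ij) ->//; rewrite preimage_set0 set0I.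
- by rewrite -setI_bigcupl -preimage_bigcup; apply: measurableI => //; exact: mpre.
Qed.

HB.instance Definition _ := isMeasure.Build _ _ _
  (trace_image mC mf) trace_image0 trace_image_ge0 trace_image_sigma_additive.
End trace_image.

Lemma measure_eq_partition d (T : measurableType d) (R : realType)
    (m1 m2 : {measure set T -> \bar R}) (I : countType) (F : I -> set T) :
  (forall i, measurable (F i)) ->
  (forall i j x, F i x -> F j x -> i = j) ->
  (forall i, m1 (F i) = m2 (F i)) ->
  m1 (\bigcup_i F i) = m2 (\bigcup_i F i).
Proof.
move=> mF dF eF; pose U k := if @choice.pickle_inv I k is Some i then F i else set0.
have mU k : measurable (U k) by rewrite /U; case: choice.pickle_inv.
have -> : \bigcup_i F i = \bigcup_k U k.
  apply/seteqP; split=> [x [i _ Fx]|x [k _]].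
    by exists (choice.pickle i) => //; rewrite /U choice.pickleK_inv.
  by rewrite /U; case: choice.pickle_inv => // i Fx; exists i.
have tU : trivIset setT U.
  move=> j k _ _ [x []]; rewrite /U.
  case ej: (choice.pickle_inv j) => [a|]//; case ek: (choice.pickle_inv k) => [b|]// Fa Fb.
  have := @choice.pickle_invK I j; have := @choice.pickle_invK I k.
  by rewrite ej ek /= (dF _ _ _ Fa Fb) => -> ->.
rewrite !measure_bigcup//; apply: eq_eseriesr => k _.
by rewrite /U; case: choice.pickle_inv => //; rewrite !measure0.
Qed.

Lemma discr_measure_eq (R : realType) (G : countGroupType)
    (m1 m2 : {measure set (discr G) -> \bar R}) :
  (forall g, m1 [set g] = m2 [set g]) -> forall B, m1 B = m2 B.
Proof.
move=> e B; have -> : B = \bigcup_(g : G) [set x | x = g /\ B g].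
  by apply/seteqP; split=> [x Bx|x [g _ [-> //]]]; exists x.
apply: measure_eq_partition => // [i j x [<- _] [<- _]//|g].
have [Bg|nBg] := pselect (B g).
  by rewrite (_ : [set x | _] = [set g]) ?e//; apply/seteqP; split=> // x [].
rewrite (_ : [set x | _] = set0) ?measure0//.
by apply/seteqP; split=> // x [].
Qed.

(** * The path space *)

Section path_space.
Context {G : countGroupType}.
Implicit Types (a b : seq G) (h : paths G).

Definition cyl a : set (paths G) := [set h | mkseq h (size a) = a].

Lemma cyl_nil : cyl [::] = setT.
Proof. by apply/seteqP; split. Qed.

Lemma cyl_rcons a g : cyl (rcons a g) = cyl a `&` [set h | h (size a) = g].
Proof.
apply/seteqP; split=> [h|h []]; rewrite /cyl /= size_rcons mkseqS.
  by move/rcons_inj => -[? ?]; split.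
by move=> -> ->.
Qed.

Lemma cylP a h : cyl a h <-> forall i, (i < size a)%N -> h i = nth 1%g a i.
Proof.
rewrite /cyl; split=> [<- i|e].
  by rewrite size_mkseq => ?; rewrite nth_mkseq.
apply: (@eq_from_nth _ 1%g); rewrite size_mkseq// => i ia.
by rewrite nth_mkseq// e.
Qed.

Lemma cyl_cat a b :
  cyl (a ++ b) = cyl a `&` [set h | cyl b (fun t => h (size a + t)%N)].
Proof.
apply/seteqP; split=> [h /cylP e|h [/cylP ea /cylP eb]].
  split; apply/cylP => i ib.
    by rewrite e ?nth_cat ?ib// size_cat ltn_addr.
  rewrite e ?size_cat ?ltn_add2l// nth_cat ltnNge leq_addr/=.
  by rewrite addnC addnK.
apply/cylP => i; rewrite size_cat nth_cat => iab.
case: ltnP => [ia|ai]; first exact: ea.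
by rewrite -eb ?subnKC// ltn_subLR.
Qed.

Lemma measurable_coord t (B : set G) : measurable [set h : paths G | B (h t)].
Proof. by apply: sub_sigma_algebra; exists t, B. Qed.

Lemma measurable_cyl a : measurable (cyl a).
Proof.
elim/last_ind: a => [|a g IH]; first by rewrite cyl_nil.
by rewrite cyl_rcons; apply: measurableI => //; exact: (@measurable_coord _ [set g]).
Qed.

(** A set of paths that is decided by finitely many coordinates is a countable
    union of cylinders, so it is measurable whatever its shape. *)
Lemma measurable_prefix n (B : set (seq G)) :
  measurable [set h : paths G | B (mkseq h n)].
Proof.
have -> : [set h : paths G | B (mkseq h n)] =
    \bigcup_(a : seq G) (if `[< B a /\ size a = n >] then cyl a else set0).
  apply/seteqP; split=> [h Bh|h [a _]].
    exists (mkseq h n) => //; rewrite asboolT/= /cyl/= ?size_mkseq//.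
  by case: asboolP => // -[Ba <-] e; rewrite /= e.
apply: countable_bigcupT_measurable => // a.
by case: ifP => // _; exact: measurable_cyl.
Qed.

Lemma measurable_finite_dep n (P : set (paths G)) :
  (forall h h', mkseq h n = mkseq h' n -> P h -> P h') -> measurable P.
Proof.
move=> dep; rewrite (_ : P = [set h : paths G |
  [set a | exists2 h', mkseq h' n = a & P h'] (mkseq h n)]).
  exact: measurable_prefix.
apply/seteqP; split=> h /=; first by exists h.
by case=> h' e; exact: dep.
Qed.

Lemma measurable_to_paths d (T : measurableType d) (F : T -> paths G) :
  (forall t B, measurable [set x | B (F x t)]) -> measurable_fun setT F.
Proof.
move=> mF; apply: measurability; first by reflexivity.
by move=> _ [_ [t [B ->]] <-]; rewrite setTI; exact: mF.
Qed.

(** Two cylinders are nested or disjoint, so that the cylinders and the empty set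
    form a pi-system, and they generate because the group is countable. *)
Lemma paths_measure_eq (R : realType) (m1 m2 : {measure set (paths G) -> \bar R}) :
  (forall a, m1 (cyl a) = m2 (cyl a)) -> (m1 setT < +oo)%E ->
  forall A, measurable A -> m1 A = m2 A.
Proof.
move=> e fin; pose C := [set X | X = set0 \/ exists a, X = cyl a].
have Cm : C `<=` measurable by move=> X [->|[a ->]] //; exact: measurable_cyl.
apply: (measure_unique C (fun=> setT)) => //.
- apply/seteqP; split.
    apply: smallest_sub; first exact: smallest_sigma_algebra.
    move=> _ [t [B ->]].
    pose GT : measurableType _ := g_sigma_algebraType C.
    suff : @measurable _ GT [set h : nat -> G | B (h t)] by [].
    have -> : [set h : nat -> G | B (h t)] = \bigcup_(a : seq G)
        (if `[< size a = t.+1 /\ B (nth 1%g a t) >] then cyl a else set0).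
      apply/seteqP; split=> [h Bh|h [a _]].
        exists (mkseq h t.+1) => //; rewrite asboolT; first by rewrite /cyl /mkset size_mkseq.
        by rewrite size_mkseq nth_mkseq.
      by case: asboolP => // -[s Ba] /cylP /(_ t); rewrite s /= => ->.
    apply: (@countable_bigcupT_measurable _ GT) => // a.
    case: ifP => _; apply: sub_sigma_algebra; first by right; exists a.
    by left.
  apply: smallest_sub => //; exact: sigma_algebra_measurable.
- move=> X Y [->|[a ->]]; first by rewrite set0I; left.
  move=> [->|[b ->]]; first by rewrite setI0; left.
  wlog ab : a b / (size a <= size b)%N.
    move=> W; have /orP[ab|ba] := leq_total (size a) (size b); first exact: W.
    by rewrite setIC; exact: W.
  have [e'|ne] := pselect (take (size a) b = a).
    right; exists b; apply/seteqP; split=> [h []//|h hb]; split => //.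
    move/cylP in hb; apply/cylP => i ia; rewrite hb ?(leq_trans ia)//.
    by rewrite -[in RHS]e' nth_take.
  left; apply/seteqP; split=> // h [/= ha hb]; apply: ne.
  by rewrite -hb /mkseq -map_take take_iota (minn_idPl ab); exact: ha.
- by move=> _; right; exists [::]; rewrite cyl_nil.
- by apply/seteqP; split=> // x _; exists 0%N.
- by move=> X [->|[a ->]]; rewrite ?measure0.
Qed.

Lemma measure_eq_words (R : realType) (m1 m2 : {measure set (paths G) -> \bar R}) n :
  (forall a, size a = n -> m1 (cyl a) = m2 (cyl a)) -> m1 setT = m2 setT.
Proof.
move=> e; have -> : setT =
    \bigcup_(a : seq G) (if size a == n then cyl a else set0).
  apply/seteqP; split=> // h _; exists (mkseq h n) => //.
  by rewrite size_mkseq eqxx /cyl/= size_mkseq.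
apply: measure_eq_partition => [a|a b h|a].
- by case: ifP => // _; exact: measurable_cyl.
- by do 2 (case: eqP => // ?); rewrite /cyl/= => <- <-; congr mkseq; congruence.
- by case: eqP => [/e//|_]; rewrite !measure0.
Qed.

End path_space.

(** * Independent increments *)

Section iid.
Context {R : realType} {G : countGroupType}.
Variables (mu : probability (discr G) R) (Q : probability (paths G) R).
Implicit Types (a b : seq G).

Definition weight a : \bar R := (\prod_(g <- a) mu [set g])%E.

Hypothesis iid : iid_law mu Q.

Lemma iid_cyl a : Q (cyl a) = weight a.
Proof.
rewrite /weight (big_nth 1%g) big_mkord -(iid _ (fun i => [set nth 1%g a i])).
by congr (Q _); apply/seteqP; split=> h /cylP.
Qed.

Lemma iid_coord t (B : set G) : Q [set h | B (h t)] = mu B.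
Proof.
pose A i : set (discr G) := if i == t then B else setT.
transitivity (Q [set h : paths G | forall i, (i < t.+1)%N -> A i (h i)]).
  congr (Q _); apply/seteqP; split=> h /=.
    by move=> Bh i _; rewrite /A; case: eqP => // ->.
  by move=> /(_ t (ltnSn t)); rewrite /A eqxx.
rewrite iid big_ord_recr/= big1 ?mul1e ?/A ?eqxx// => i _.
by rewrite ltn_eqF ?probability_setT.
Qed.

Definition drop_path n (h : paths G) : paths G := fun t => h (n + t)%N.

Lemma measurable_drop_path n : measurable_fun setT (drop_path n).
Proof.
by apply: measurable_to_paths => t B; exact: (@measurable_coord _ (n + t) B).
Qed.

(** The Markov property at a deterministic time; by uniqueness of measures it is
    enough that concatenation of words multiplies their weights. *)
Lemma iid_markov a (B : set (paths G)) : measurable B ->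
  Q (drop_path (size a) @^-1` B `&` cyl a) = (Q (cyl a) * Q B)%E.
Proof.
move=> mB; have mC := measurable_cyl a.
have fa : Q (cyl a) \is a fin_num by exact: fin_num_measure.
pose w : {nonneg R} := NngNum (fine_ge0 (measure_ge0 Q (cyl a))).
pose m1 := trace_image Q mC (measurable_drop_path (size a)).
rewrite -[LHS]/(m1 B) -[X in (X * _)%E]fineK//.
rewrite -[RHS]/(mscale w Q B).
apply: paths_measure_eq => // [b|].
  rewrite /= /m1 /trace_image /mscale/= fineK// setIC -[X in _ `&` X]/[set h | _ _].
  have := cyl_cat a b; rewrite /drop_path /preimage /= => <-.
  by rewrite !iid_cyl /weight big_cat.
rewrite (@le_lt_trans _ _ 1%E) ?ltry//.
by apply: probability_le1; rewrite preimage_setT setTI.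
Qed.

End iid.

(** * Existence of sequences of independent increments *)

Section iid_existence.
Context {R : realType} {G : countGroupType}.
Variable mu : probability (discr G) R.
Implicit Types (a b : seq G) (g : G) (x y : R).

(** The sets A i are freed one at a time from the left: once the first letters are
    fixed by a word, both sides are measures in A 0 that agree on singletons. *)
Lemma iid_law_cyl (Q : probability (paths G) R) :
  (forall a, Q (cyl a) = weight mu a) -> iid_law mu Q.
Proof.
move=> Qcyl n A.
suff H : forall a, Q (cyl a `&` [set h | forall i, (i < n)%N -> A i (h (size a + i)%N)]) =
    (weight mu a * \prod_(i < n) mu (A i))%E.
  by have := H [::]; rewrite cyl_nil setTI /weight big_nil mul1e.
elim: n A => [|n IH] A a.
  rewrite big_ord0 mule1 -Qcyl; congr (Q _).
  by apply/seteqP; split=> [h []|h].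
pose C := cyl a `&` [set h | forall i, (i < n)%N -> A i.+1 (h (size a + i.+1)%N)].
have mC : measurable C.
  apply: measurableI; first exact: measurable_cyl.
  rewrite (_ : [set h | _] = \bigcap_(i in `I_n)
      [set h : paths G | A i.+1 (h (size a + i.+1)%N)]); last by apply/seteqP; split.
  apply: bigcap_measurableType => i _.
  exact: (@measurable_coord _ (size a + i.+1)).
have mf : measurable_fun setT (fun h : paths G => h (size a) : discr G).
  by move=> _ B _; rewrite setTI; exact: measurable_coord.
pose c := (weight mu a * \prod_(i < n) mu (A i.+1))%E.
have c0 : (0 <= c)%E.
  by apply: mule_ge0; rewrite /weight; apply: prode_ge0.
have cfin : c \is a fin_num.
  by rewrite /c /weight fin_numM// prode_fin_num// => *; rewrite fin_num_measure.
pose w : {nonneg R} := NngNum (fine_ge0 c0).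
transitivity (trace_image Q mC mf (A 0%N)).
  congr (Q _); apply/seteqP; split=> [h [ah hA]|h [/= hA0 [ah hA]]].
    split; first by have := hA 0%N isT; rewrite addn0.
    by split => // i i_n; exact: hA.
  split => // -[|i] i_n; first by rewrite addn0.
  exact: hA.
transitivity (mscale w mu (A 0%N)); last first.
  rewrite -[LHS]/((fine c)%:E * mu (A 0%N))%E fineK//.
  by rewrite /c big_ord_recl muleA muleAC.
apply: discr_measure_eq => g.
rewrite -[RHS]/((fine c)%:E * mu [set g])%E fineK//.
transitivity (weight mu (rcons a g) * \prod_(i < n) mu (A i.+1))%E; last first.
  by rewrite /c /weight -cats1 big_cat big_seq1 muleAC.
rewrite -(IH (fun i => A i.+1)) /trace_image; congr (Q _).
apply/seteqP; split=> h.
  by move=> [/= hg [ah hA]]; rewrite cyl_rcons size_rcons; split => // i i_n;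
    rewrite addSnnS; exact: hA.
rewrite cyl_rcons size_rcons => -[[ah hg] hA]; split => //; split => // i i_n.
by rewrite -addSnnS; exact: hA.
Qed.

Let mass g : R := fine (mu [set g]).
Let pmass (k : nat) : R := fine (mu [set g | choice.pickle g = k]).
Let cum (k : nat) : R := \sum_(j < k) pmass j.

Let mass_ge0 g : 0 <= mass g.
Proof. exact: fine_ge0. Qed.

Let pmass_ge0 k : 0 <= pmass k.
Proof. exact: fine_ge0. Qed.

Let pmass_pickle g : pmass (choice.pickle g) = mass g.
Proof.
rewrite /pmass /mass; congr (fine (mu _)); apply/seteqP; split=> [g' /=|g' ->//].
exact: (pcan_inj choice.pickleK).
Qed.

Let cum_le j k : (j <= k)%N -> cum j <= cum k.
Proof.
move=> jk; rewrite /cum -(subnK jk) addnC big_split_ord/= lerDl.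
by apply: sumr_ge0.
Qed.

Let cumS g : cum (choice.pickle g).+1 = cum (choice.pickle g) + mass g.
Proof. by rewrite /cum big_ord_recr/= pmass_pickle. Qed.

Let cumE k : (cum k)%:E = mu [set g | (choice.pickle g < k)%N].
Proof.
elim: k => [|k IH].
  rewrite /cum big_ord0 (_ : [set g | _] = set0) ?measure0//.
  by apply/seteqP; split.
rewrite /cum big_ord_recr/= -/(cum k) EFinD IH fineK ?fin_num_measure//.
rewrite -measureU//; last by apply/seteqP; split=> // g [/=] + e; rewrite e ltnn.
congr (mu _); apply/seteqP; split=> g /=; first by case=> [/ltnW|->].
by rewrite ltnS leq_eqVlt => /orP[/eqP|]; [right|left].
Qed.

Let cum_le1 k : cum k <= 1.
Proof. by rewrite -lee_fin cumE probability_le1. Qed.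

Let cum_gt y : y < 1 -> exists k, y < cum k.
Proof.
move=> y1; apply: contrapT => /forallNP H.
have : (mu setT <= y%:E)%E.
  rewrite (_ : setT = \bigcup_k [set g | choice.pickle g = k]); last first.
    by apply/seteqP; split=> // g _; exists (choice.pickle g).
  rewrite measure_semi_bigcup//; last first.
    by apply/trivIsetP => i j _ _ /eqP ij; apply/seteqP; split=> // g [/= -> /ij].
  apply: lime_le; first by apply: is_cvg_nneseries.
  apply: nearW => k; have /negP := H k; rewrite -leNgt -lee_fin; apply: le_trans.
  rewrite /cum big_mkord -sumEFin; apply: lee_sum => i _.
  by rewrite fineK// fin_num_measure.
by rewrite probability_setT lee_fin leNgt y1.
Qed.

Let slot y : 0 <= y < 1 -> exists g, cum (choice.pickle g) <= y < cum (choice.pickle g).+1.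
Proof.
move=> /andP[y0 /cum_gt/ex_minnP[[|k] yk kmin]].
  by move: yk; rewrite /cum big_ord0 ltNge y0.
have ky : cum k <= y by rewrite leNgt; apply/negP => /kmin; rewrite ltnn.
have [[g gk]|ne] := pselect (exists g, choice.pickle g = k).
  by exists g; rewrite gk ky yk.
move: yk; rewrite /cum big_ord_recr/= -/(cum k) /pmass.
rewrite (_ : [set g | _] = set0) ?measure0 ?addr0 ?ltNge ?ky//.
by apply/seteqP; split=> // g gk; apply: ne; exists g.
Qed.

(** The interval [0, 1) is cut into consecutive intervals of lengths mu(g), each
    of these is cut in the same proportions, and so on.  The sequence of the
    pieces that contain a Lebesgue-distributed point is i.i.d. with law mu, since
    a word gets an interval whose length is the weight of the word.  A letter put
    in front rescales the whole subdivision into the piece of that letter. *)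
Fixpoint left_end a : R :=
  if a is g :: b then cum (choice.pickle g) + mass g * left_end b else 0.
Definition len a : R := \prod_(g <- a) mass g.

Let len_ge0 a : 0 <= len a.
Proof. by rewrite /len; apply: prodr_ge0. Qed.

Let left_end_rcons a g :
  left_end (rcons a g) = left_end a + len a * cum (choice.pickle g).
Proof.
elim: a => [|g' a IH] /=; first by rewrite /len big_nil mulr0 addr0 add0r mul1r.
by rewrite IH /len big_cons mulrDr addrA mulrA.
Qed.

Let len_rcons a g : len (rcons a g) = len a * mass g.
Proof. by rewrite /len -cats1 big_cat big_seq1. Qed.

Let right_end_rcons a g : left_end (rcons a g) + len (rcons a g) =
  left_end a + len a * cum (choice.pickle g).+1.
Proof. by rewrite left_end_rcons len_rcons cumS mulrDr addrA. Qed.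

Definition word_itv a : set R := `[left_end a, left_end a + len a[%classic.

Let word_itvP a x : word_itv a x <-> left_end a <= x < left_end a + len a.
Proof. by rewrite /word_itv /= in_itv. Qed.

Let word_itv_nil x : word_itv [::] x <-> 0 <= x < 1.
Proof. by rewrite word_itvP /= /len big_nil add0r. Qed.

Let word_itv_sub a g x : word_itv (rcons a g) x -> word_itv a x.
Proof.
rewrite !word_itvP right_end_rcons left_end_rcons => /andP[lx xr].
apply/andP; split; first by apply: le_trans lx; rewrite lerDl mulr_ge0// sumr_ge0.
apply: (lt_le_trans xr); rewrite lerD2l -[leRHS]mulr1.
exact: ler_wpM2l.
Qed.

Let word_itv_ex a x : word_itv a x -> exists g, word_itv (rcons a g) x.
Proof.
rewrite word_itvP => /andP[lx xr].
have w0 : 0 < len a by rewrite -(ltrD2l (left_end a)) addr0 (le_lt_trans lx).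
have [|g /andP[gy yg]] := @slot ((x - left_end a) / len a).
  by rewrite divr_ge0 ?subr_ge0//= ltr_pdivrMr// mul1r ltrBlDl.
exists g; rewrite word_itvP right_end_rcons left_end_rcons; apply/andP; split.
  by move: gy; rewrite ler_pdivlMr// lerBrDl mulrC.
by move: yg; rewrite ltr_pdivrMr// ltrBlDl mulrC.
Qed.

Let word_itv_uniq a g g' x :
  word_itv (rcons a g) x -> word_itv (rcons a g') x -> g = g'.
Proof.
move=> gx g'x; apply: (pcan_inj choice.pickleK).
wlog gg' : g g' gx g'x / (choice.pickle g < choice.pickle g')%N.
  by move=> W; have [/W->//|/W->//|//] := ltngtP (choice.pickle g) (choice.pickle g').
move: gx g'x; rewrite !word_itvP !right_end_rcons !left_end_rcons.
move=> /andP[_ xr] /andP[lx _]; move: (le_lt_trans lx xr).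
by rewrite ltrD2l ltNge ler_wpM2l// cum_le.
Qed.

(* Points outside [0, 1) get the constant word 1. *)
Let next x a : G := xget 1%g [set g | word_itv (rcons a g) x].

Fixpoint word_at x n : seq G :=
  if n is n'.+1 then rcons (word_at x n') (next x (word_at x n')) else [::].

Definition path_at (x : measurableTypeR R) : paths G := fun n => next x (word_at x n).

Let mkseq_path_at x n : mkseq (path_at x) n = word_at x n.
Proof. by elim: n => //= n IH; rewrite mkseqS IH. Qed.

Let word_itv_word_at x n : 0 <= x < 1 -> word_itv (word_at x n) x.
Proof.
move=> x01; elim: n => [|n IH]; first exact/word_itv_nil.
have [g gx] := word_itv_ex IH.
by rewrite /= /next; case: xgetP => [g' _ //|/(_ g)].
Qed.

Let word_at_word_itv a x : word_itv a x -> word_at x (size a) = a.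
Proof.
elim/last_ind: a => // a g IH agx; rewrite size_rcons /= IH; last exact: word_itv_sub agx.
congr rcons; apply: (word_itv_uniq _ agx).
by rewrite /next; case: xgetP => [g' _ //|/(_ g)].
Qed.

Let word_itv01 a x : word_itv a x -> 0 <= x < 1.
Proof.
elim/last_ind: a => [/word_itv_nil//|a g IH /word_itv_sub]; exact: IH.
Qed.

Let path_at_cyl a : path_at @^-1` cyl a `&` `[0, 1[%classic = word_itv a.
Proof.
apply/seteqP; split=> [x [/= xa]|x ax]; rewrite ?in_itv/=.
  by move: xa; rewrite /cyl/= mkseq_path_at => <-; exact: word_itv_word_at.
split; last by rewrite /= in_itv/=; exact: word_itv01 ax.
by rewrite /cyl /= mkseq_path_at; exact: word_at_word_itv.
Qed.

Let path_at_out x : ~ (0 <= x < 1) -> forall t, path_at x t = 1%g.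
Proof.
move=> x01 t; rewrite /path_at /next; case: xgetP => // g _ /word_itv01.
by move/x01.
Qed.

Let measurable_path_at : measurable_fun setT path_at.
Proof.
apply: measurable_to_paths => t B; pose I01 : set (measurableTypeR R) := `[0, 1[%classic.
have mI : measurable I01 by exact: measurable_itv.
(* Inside [0, 1), a countable union of word intervals; outside, the path is
   constant. *)
rewrite -(setUIDK [set x | _] I01); apply: measurableU.
  rewrite (_ : _ `&` _ = \bigcup_(a : seq G)
      if `[< size a = t.+1 /\ B (nth 1%g a t) >] then word_itv a else set0).
    apply: countable_bigcupT_measurable => // a.
    by case: ifP => // _; exact: measurable_itv.
  apply/seteqP; split=> [x [/= xB x01]|x [a _]].
    exists (word_at x t.+1) => //; rewrite asboolT.
      by apply: word_itv_word_at; move: x01; rewrite /I01/= in_itv.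
    rewrite -mkseq_path_at size_mkseq; split=> //.
    by rewrite nth_mkseq.
  case: asboolP => // -[sa Ba] ax; split; last first.
    by rewrite /I01/= in_itv; exact: word_itv01 ax.
  by rewrite /= -(word_at_word_itv ax) -mkseq_path_at sa nth_mkseq in Ba *.
rewrite (_ : _ `\` _ = ~` I01 `&` (if `[< B 1%g >] then setT else set0)).
  by apply: measurableI; [exact: measurableC|case: ifP].
apply/seteqP; split=> x.
  move=> [/= xB xI]; have x01 : ~ (0 <= x < 1) by move: xI; rewrite /I01/= in_itv.
  by split=> //; rewrite asboolT// -(path_at_out x01 t).
move=> [/= xI]; case: asboolP => // B1 _; split => //=.
by rewrite path_at_out//; move: xI; rewrite /I01/= in_itv.
Qed.

Let unit_itv : set (measurableTypeR R) := `[0, 1[%classic.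
Let measurable_unit_itv : measurable unit_itv. Proof. exact: measurable_itv. Qed.

Definition iid_measure : set (paths G) -> \bar R :=
  trace_image lebesgue_measure measurable_unit_itv measurable_path_at.

HB.instance Definition _ := Measure.on iid_measure.

Let iid_measure_cyl a : iid_measure (cyl a) = weight mu a.
Proof.
rewrite /iid_measure /trace_image path_at_cyl /word_itv.
have := lebesgue_measure_itv `[left_end a, left_end a + len a[.
rewrite /mkset /= => ->.
transitivity (len a)%:E.
  rewrite lte_fin ltrDl; case: ltP => [_|w0].
    by rewrite -EFinB addrAC subrr add0r.
  by congr (_%:E); apply/eqP; rewrite eq_le len_ge0 w0.
rewrite /len /weight; elim: a => [|g a IH]; first by rewrite !big_nil.
by rewrite !big_cons EFinM IH fineK// fin_num_measure.
Qed.

Let iid_measureT : iid_measure setT = 1%E.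
Proof. by rewrite -(@cyl_nil G) iid_measure_cyl /weight big_nil. Qed.

HB.instance Definition _ := Measure_isProbability.Build _ _ _
  iid_measure iid_measureT.

Lemma iid_exists : exists Q : probability (paths G) R, iid_law mu Q.
Proof. by exists iid_measure; exact: iid_law_cyl. Qed.

End iid_existence.

(** * The zero-one law *)

(** The event to be transported is cut along the sets E k, and a different
    transformation is used on each piece; since theta k preserves E k and Q, no
    mass moves from one piece to another. *)
Lemma eq_probability_swaps d (T : measurableType d) (R : realType)
    (Q : probability T R) (E : nat -> set T) (theta : nat -> T -> T)
    (P P' : set T) :
  (forall k, measurable (E k)) -> measurable P -> measurable P' ->
  (forall i j x, E i x -> E j x -> i = j) ->
  Q (~` \bigcup_k E k) = 0%E ->
  (forall k x, E k (theta k x) <-> E k x) ->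
  (forall k B, measurable B -> Q (theta k @^-1` B) = Q B) ->
  (forall k x, E k x -> (P' x <-> P (theta k x))) ->
  Q P' = Q P.
Proof.
move=> mE mP mP' dE nE iE pres conj.
have mUE : measurable (\bigcup_k E k) by exact: bigcupT_measurable.
have key X : measurable X -> Q X = Q (\bigcup_k E k `&` X).
  move=> mX; rewrite (measureDI Q mX mUE).
  rewrite -[RHS]add0e setIC; congr (_ + _)%E.
  apply/eqP; rewrite eq_le measure_ge0 andbT -[leRHS]nE.
  apply: le_measure; [by rewrite inE; exact: measurableD|by rewrite inE; exact: measurableC|].
  by move=> x [].
rewrite (key _ mP) (key _ mP').
rewrite -/(mrestr Q mP' (\bigcup_k E k)) -/(mrestr Q mP (\bigcup_k E k)).
apply: measure_eq_partition => // k.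
transitivity (Q (theta k @^-1` (E k `&` P))); last by apply: pres; exact: measurableI.
congr (Q _); apply/seteqP; split=> x; rewrite /preimage/=.
  by move=> [Ex P'x]; split; [exact/iE|exact/conj].
by move=> [/iE Ex Px]; split => //; exact/(conj _ _ Ex).
Qed.

Section zero_one.
Context {R : realType} {G : countGroupType}.
Implicit Types (mu : probability (discr G) R) (Q : probability (paths G) R).
Implicit Types (a b : seq G) (g : G) (h w : paths G).

Definition word_prod a : G := (\prod_(g <- a) g)%g.

Lemma walkE h n : walk h n = word_prod (mkseq h n).
Proof. by rewrite /walk /word_prod /mkseq big_map -(big_mkord xpredT h) /index_iota subn0. Qed.

Lemma walkS h n : walk h n.+1 = (walk h n * h n)%g.
Proof. by rewrite /walk big_ord_recr. Qed.

Definition translate g w : paths G := fun t => (g * w t)%g.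

Lemma walk_cyl a h : cyl a h ->
  drop_path (size a) (walk h) =
  translate (word_prod a) (walk (drop_path (size a) h)).
Proof.
move=> ah; apply/funext => t; rewrite /drop_path /translate !walkE.
rewrite /word_prod /mkseq iotaD add0n map_cat big_cat/=; congr (_ * _)%g.
  by rewrite -{2}ah.
by rewrite -{1}(addn0 (size a)) iotaDl -map_comp.
Qed.

Lemma shift_invariant_drop (A : set (paths G)) n w :
  time_shift @^-1` A = A -> A (drop_path n w) <-> A w.
Proof.
move=> invA; elim: n => [|n <-]; first by [].
rewrite -[in X in _ <-> X]invA; suff -> : drop_path n.+1 w = time_shift (drop_path n w) by [].
by apply/funext => t; rewrite /time_shift /drop_path addSnnS.
Qed.

Definition hit g (A : set (paths G)) : set (paths G) :=
  [set h | A (translate g (walk h))].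

Lemma measurable_translate_walk g :
  measurable_fun setT (fun h => translate g (walk h)).
Proof.
apply: measurable_to_paths => t B; rewrite (_ : [set h | _] =
    [set h : paths G | [set a | B (g * word_prod a)%g] (mkseq h t)]).
  exact: measurable_prefix.
by apply/seteqP; split=> h /=; rewrite /translate walkE.
Qed.

Lemma measurable_walk : measurable_fun setT (@walk G).
Proof.
have := measurable_translate_walk 1%g.
have -> // : (fun h => translate 1%g (walk h)) = @walk G.
by apply/funext => h; apply/funext => t; rewrite /translate mul1g.
Qed.

HB.instance Definition _ := isMeasurableFun.Build _ _ _ _ (@walk G) measurable_walk.

Lemma measurable_hit g (A : set (paths G)) : measurable A -> measurable (hit g A).
Proof.
by move=> mA; rewrite -[X in measurable X]setTI; exact: measurable_translate_walk.
Qed.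

Definition coordinatewise (c : nat -> G -> G) (h : paths G) : paths G :=
  fun t => c t (h t).

Lemma iid_involution mu Q (c : nat -> G -> G) (B : set (paths G)) :
  iid_law mu Q -> (forall t, involutive (c t)) ->
  (forall t g, mu [set c t g] = mu [set g]) ->
  measurable B -> Q (coordinatewise c @^-1` B) = Q B.
Proof.
move=> iid cK cmu mB.
have mc : measurable_fun setT (coordinatewise c).
  apply: measurable_to_paths => t X.
  exact: (@measurable_coord _ t [set g | X (c t g)]).
transitivity (trace_image Q measurableT mc B).
  by rewrite /trace_image setIT.
apply: paths_measure_eq => // [a|]; last first.
  by rewrite /trace_image/= preimage_setT setTI probability_setT ltry.
pose b := mkseq (fun i => c i (nth 1%g a i)) (size a).
transitivity (Q (cyl b)).
  rewrite /= /trace_image setIT; congr (Q _); apply/seteqP; split=> h /cylP ah.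
    apply/cylP => i; rewrite size_mkseq => ia; rewrite nth_mkseq// -ah//.
    by rewrite cK.
  apply/cylP => i ia; move: (ah i); rewrite size_mkseq nth_mkseq// /coordinatewise => ->//.
  by rewrite cK.
transitivity (weight mu a); last by rewrite -(iid_cyl iid).
rewrite (iid_cyl iid) /weight [LHS](big_nth 1%g) [RHS](big_nth 1%g) size_mkseq !big_mkord.
by apply: eq_bigr => i _; rewrite nth_mkseq// cmu.
Qed.

(** The conditional probability of an invariant event A given that the first
    increments spell the word [a] is the probability that the walk issued from
    the product of [a] hits A.  If it is the same for all words of the same length
    and of positive weight, then A is independent of every cylinder, hence of itself. *)
Lemma liouville_criterion mu :
  (forall Q (A : set (paths G)) a b, iid_law mu Q -> measurable A ->
     time_shift @^-1` A = A -> size a = size b ->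
     weight mu a != 0%E -> weight mu b != 0%E ->
     Q (hit (word_prod a) A) = Q (hit (word_prod b) A)) ->
  liouville mu.
Proof.
move=> indep P [Q iid PQ] A mA invA; rewrite PQ//.
set W := walk @^-1` A.
have mhit g := measurable_hit g mA.
have mW : measurable W.
  by rewrite -[X in measurable X]setTI; exact: measurable_walk.
have Wcyl a : Q (W `&` cyl a) = (Q (cyl a) * Q (hit (word_prod a) A))%E.
  rewrite -(iid_markov iid)//; congr (Q _); apply/seteqP; split=> h [Wh ah]; split => //.
    move: Wh; rewrite /W /hit /preimage/= -(shift_invariant_drop (size a) _ invA).
    by rewrite walk_cyl.
  by rewrite /W /preimage/= -(shift_invariant_drop (size a) _ invA) walk_cyl.
have Qfin (X : set (paths G)) : measurable X -> Q X \is a fin_num.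
  by move=> mX; rewrite fin_num_measure.
have null a : weight mu a = 0%E -> Q (W `&` cyl a) = 0%E.
  by rewrite Wcyl (iid_cyl iid) => ->; rewrite mul0e.
(* Summing over the words of the length of [a], whose terms of zero weight
   vanish on both sides. *)
have hitW a : weight mu a != 0%E -> Q (hit (word_prod a) A) = Q W.
  move=> a0; set q := Q (hit _ _); have q0 : (0 <= q)%E by exact: measure_ge0.
  pose qn : {nonneg R} := NngNum (fine_ge0 q0).
  have qE : (qn%:num)%:E = q by rewrite /= fineK// Qfin.
  have : mrestr Q mW setT = mscale qn Q setT.
    apply: (@measure_eq_words _ _ _ _ (size a)) => b ba.
    transitivity (Q (cyl b `&` W)) => //.
    transitivity ((qn%:num)%:E * Q (cyl b))%E => //.
    rewrite qE setIC.
    have [b0|b0] := eqVneq (weight mu b) 0%E.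
      by rewrite null// (iid_cyl iid) b0 mule0.
    by rewrite Wcyl muleC (indep _ _ b a).
  by rewrite /mrestr/= /mscale/= qE probability_setT mule1 setTI.
pose qn : {nonneg R} := NngNum (fine_ge0 (measure_ge0 Q W)).
have qE : (qn%:num)%:E = Q W by rewrite /= fineK// Qfin.
(* With X := W this is Q W = Q W * Q W. *)
have indepW X : measurable X -> Q (X `&` W) = (Q W * Q X)%E.
  move=> mX; transitivity (mrestr Q mW X) => //.
  transitivity (mscale qn Q X); last by rewrite /mscale/= qE.
  apply: paths_measure_eq => // [a|]; last first.
    change (Q (setT `&` W) < +oo)%E.
    by rewrite setTI (le_lt_trans (probability_le1 _ _))// ltry.
  transitivity (Q (cyl a `&` W)) => //.
  transitivity ((qn%:num)%:E * Q (cyl a))%E => //.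
  rewrite qE setIC.
  have [a0|a0] := eqVneq (weight mu a) 0%E.
    by rewrite null// (iid_cyl iid) a0 mule0.
  by rewrite Wcyl muleC hitW.
have := indepW _ mW; rewrite setIid -qE -EFinM => -[e].
have /eqP : qn%:num * (1 - qn%:num) = 0 by rewrite mulrBr mulr1 -e subrr.
rewrite mulf_eq0 subr_eq0 => /orP[/eqP ->|/eqP <-]; by [left|right].
Qed.

Lemma liouville_zero_one mu Q (A : set (paths G)) :
  liouville mu -> iid_law mu Q -> measurable A -> time_shift @^-1` A = A ->
  Q (walk @^-1` A) = 0%E \/ Q (walk @^-1` A) = 1%E.
Proof.
move=> L iid mA invA; apply: (L (distribution Q (@walk G)) _ A mA invA).
by exists Q.
Qed.

End zero_one.

(** * Borel-Cantelli and the first moment *)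

Section borel_cantelli.
Context {R : realType} {G : countGroupType}.

(** The second Borel-Cantelli lemma: the product of the 1 - p i is at most
    exp (- \sum_i p i). *)
Lemma iid_never_hit (mu : probability (discr G) R) (Q : probability (paths G) R)
    (L : nat -> set (discr G)) :
  iid_law mu Q -> (\sum_(0 <= i <oo) mu (L i))%E = +oo%E ->
  Q [set h | forall i, ~ L i (h i)] = 0%E.
Proof.
move=> iid Loo; pose N : set (paths G) := [set h | forall i, ~ L i (h i)]; rewrite -/N.
pose p i := fine (mu (L i)).
have pE i : mu (L i) = (p i)%:E by rewrite /p fineK// fin_num_measure.
have mN : measurable N.
  rewrite (_ : N = \bigcap_i [set h : paths G | (~` L i) (h i)]).
    by apply: bigcap_measurableType => i _; exact: measurable_coord.
  by apply/seteqP; split=> [h Nh i _|h Nh i]; [exact: Nh|exact: (Nh i I)].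
have large (B : R) : exists n, B < \sum_(0 <= i < n) p i.
  apply: contrapT => /forallNP H.
  have : (\sum_(0 <= i <oo) mu (L i) <= B%:E)%E.
    apply: lime_le; first by apply: is_cvg_nneseries.
    apply: nearW => n; rewrite (eq_bigr (fun i => (p i)%:E)) => [|i _]; last exact: pE.
    by rewrite sumEFin lee_fin leNgt; apply/negP/H.
  by rewrite Loo leye_eq.
have bound n : (Q N <= (expR (- \sum_(0 <= i < n) p i))%:E)%E.
  apply: (@le_trans _ _ (\prod_(i < n) mu (~` L i))%E).
    rewrite -(iid n (fun i => ~` L i)); apply: le_measure; rewrite ?inE//; last by move=> h Nh i _; exact: Nh.
    rewrite (_ : [set h | _] =
        \bigcap_(i in `I_n) [set h : paths G | (~` L i) (h i)]); last first.
      by apply/seteqP; split.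
    by apply: bigcap_measurableType => i _; exact: measurable_coord.
  rewrite (eq_bigr (fun i : 'I_n => (1 - p i)%:E)) => [|i _]; last first.
    by rewrite probability_setC// pE EFinB.
  rewrite prodEFin lee_fin -sumrN expR_sum big_mkord; apply: ler_prod => i _.
  have pi1 : p i <= 1 by rewrite -lee_fin -pE probability_le1.
  by rewrite subr_ge0 pi1 expR_ge1Dx.
have Qfin : Q N \is a fin_num by rewrite fin_num_measure.
apply/eqP; rewrite -(fineK Qfin) eqe; apply/negPn/negP => r0.
(* The sum is taken beyond 1 / Q N, and exp B > B. *)
have {}r0 : 0 < fine (Q N) by rewrite lt_def r0 fine_ge0.
have [n] := large (fine (Q N))^-1; set B := \sum_(_ <= _ < _) _ => nB.
have := bound n; rewrite -/B -(fineK Qfin) lee_fin leNgt => /negP; apply.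
rewrite expRN -[ltRHS]invrK ltf_pV2 ?posrE ?invr_gt0 ?expR_gt0//.
by rewrite (lt_le_trans nB)// (le_trans _ (expR_ge1Dx _))// lerDr.
Qed.

End borel_cantelli.

Section first_moment.
Context {R : realType}.
Variable alpha : probability nat R.
Local Open Scope ereal_scope.

Lemma positive_law0 : alpha [set n | (0 < n)%N] = 1 -> alpha [set 0%N] = 0.
Proof.
move=> pos; rewrite (_ : [set 0%N] = ~` [set n | (0 < n)%N]).
  by rewrite probability_setC// pos subee.
by apply/seteqP; split=> [_ -> //|[|n] //= /(_ isT)].
Qed.

Lemma law_nat_sum (B : set nat) :
  alpha B = \sum_(0 <= n <oo) (if n \in B then alpha [set n] else 0).
Proof.
rewrite -eseries_mkcond -measure_bigcup//.
  by congr (alpha _); apply/seteqP; split=> [n Bn|n [k Bk /= ->]//]; exists n.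
by move=> i j _ _ [n [/= <- <-]].
Qed.

Lemma tail_sum : \sum_(0 <= j <oo) alpha [set n | (j < n)%N] =
  \sum_(1 <= n <oo) n%:R%:E * alpha [set n].
Proof.
transitivity (\sum_(0 <= j <oo) \sum_(0 <= n <oo)
    (if (j < n)%N then alpha [set n] else 0)).
  apply: eq_eseriesr => j _; rewrite law_nat_sum; apply: eq_eseriesr => n _.
  by congr (if _ then _ else _); apply/idP/idP; rewrite inE.
rewrite (@nneseries_interchange _ (fun j n => if (j < n)%N then alpha [set n] else 0)
  xpredT xpredT); last by move=> i j; case: ifP.
transitivity (\sum_(0 <= n <oo) n%:R%:E * alpha [set n]).
  apply: eq_eseriesr => n _; rewrite (nneseries_split 0 n); last by move=> k _; case: ifP.
  rewrite add0n [X in _ + X]eseries0 ?adde0; last first.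
    by move=> i ni _; rewrite ltnNge ni.
  rewrite big_mkord (eq_bigr (fun=> alpha [set n])); last by move=> i _; rewrite ltn_ord.
  rewrite -(fineK (fin_num_measure alpha [set n] _))// sumEFin sumr_const card_ord.
  by rewrite -EFinM mulr_natl.
rewrite (nneseries_split 0 1); last by move=> k _; apply: mule_ge0.
by rewrite big_nat1 mul0e add0e.
Qed.

(** A window that has to be longer than j + k at the time j still occurs almost
    surely: dropping the first k tails removes only a finite mass. *)
Lemma tail_sum_late k :
  \sum_(1 <= n <oo) n%:R%:E * alpha [set n] = +oo ->
  \sum_(0 <= j <oo) alpha [set n | (j + k < n)%N] = +oo.
Proof.
rewrite -tail_sum (nneseries_split 0 k)//.
rewrite (@nneseries_addn _ (fun j => alpha [set n | (j < n)%N]))// add0n.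
set c := (X in X + _); move: (limn _) => t.
have : c \is a fin_num by apply/sum_fin_numP => i _ _; rewrite fin_num_measure.
by case: c t => [r||] [s||] //=.
Qed.
End first_moment.

(** * Walks on the lamplighter group *)

Section configurations.
Implicit Types (phi psi delta : conf) (n k M : nat).

Lemma conf_addrr phi : phi + phi = 0.
Proof.
apply/confP => z; rewrite confD conf0z; move: (phi z) => x.
by apply: val_inj; case: x => [[|[|]]].
Qed.

Lemma conf_bounded phi : exists M, forall z, phi z != 0 -> (`|z| <= M)%N.
Proof.
exists (\max_(z <- finsupp phi) `|z|%N) => z.
rewrite -mem_finsupp => zphi.
exact: (@leq_bigmax_seq _ _ xpredT (fun z : int => `|z|%N)).
Qed.

Lemma Kset_inj m n phi : Kset m phi -> Kset n phi -> m = n.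
Proof.
move=> [sm em] [sn en]; apply/eqP; rewrite eqn_leq.
have := sn m%:Z; have := sm n%:Z; rewrite em en !lez_nat.
by move=> /(_ isT) /andP[_ ->] /(_ isT) /andP[_ ->].
Qed.

(** Adding the shifted delta keeps the highest lamp n untouched because n exceeds
    k + M, and creates no lamp below 0 because k is at least M. *)
Lemma Kset_flip delta M k n phi : (forall z, delta z != 0 -> (`|z| <= M)%N) ->
  (M <= k)%N -> (k + M < n)%N -> Kset n phi -> Kset n (phi + shift k%:Z delta).
Proof.
move=> supp Mk kMn [sphi ephi]; split=> [z|].
  rewrite confD shiftE; have [z0|/sphi//] := eqVneq (phi z) 0.
  by rewrite z0 add0r => /supp zM; apply/andP; split; lia.
rewrite confD shiftE ephi; have [->|/supp] := eqVneq (delta (n%:Z - k%:Z)) 0.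
  by rewrite addr0.
by lia.
Qed.

End configurations.

(** Uniformity enters only in this form: it makes every bijection that preserves
    K_n preserve the measure. *)
Lemma kappa_singleton (R : realType) n (phi psi : conf) :
  (Kset n phi <-> Kset n psi) -> kappa n [set phi] = kappa n [set psi] :> \bar R.
Proof.
suff H chi : kappa n [set chi] =
    (((`[< Kset n chi >] : nat)%:R / (#|` fset_set (Kset n)|)%:R)%:E : \bar R).
  by rewrite !H => e; congr ((_%:R / _)%:E); congr nat_of_bool; exact/asbool_equiv_eq.
rewrite /kappa /unif; congr ((_%:R / _)%:E); case: asboolP => K.
  rewrite (_ : _ `&` _ = [set chi]) ?fset_set1 ?cardfs1//.
  by apply/seteqP; split=> [x []//|x ->].
rewrite (_ : _ `&` _ = set0) ?fset_set0 ?cardfs0//.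
by apply/seteqP; split=> // x [Kx xc]; apply: K; rewrite -xc.
Qed.

(** The measure mu stands for both projections, and nu n for the corresponding
    marginal of the n-th coupling; nu 0 has weight zero. *)
Section lamplighter.
Context {R : realType}.
Variables (alpha : probability nat R) (nu : nat -> probability (discr conf) R)
  (mu : probability (discr lamp) R).
Hypothesis alpha_pos : alpha [set n | (0 < n)%N] = 1%E.
Hypothesis nu_kappa : forall n, (0 < n)%N -> nu n =1 kappa n.
Hypothesis nu_Kset : forall n, (0 < n)%N -> nu n (Kset n) = 1%E.
Hypothesis moment : (\sum_(1 <= n <oo) n%:R%:E * alpha [set n])%E = +oo%E.
Hypothesis muE : forall A, mu A =
  (\sum_(0 <= n <oo) alpha [set n] * nu n [set phi | A ((-1)%R, phi)])%E.

Lemma down_increments : mu [set g | g.1 != -1] = 0%E.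
Proof.
rewrite muE eseries0// => n _ _.
rewrite (_ : [set phi | _] = set0) ?measure0 ?mule0//.
by apply/seteqP; split=> // phi /=; rewrite eqxx.
Qed.

Lemma word_prod_down (a : seq lamp) : weight mu a != 0%E ->
  (word_prod a).1 = - (size a)%:Z.
Proof.
rewrite /word_prod /weight; elim: a => [|g a IH]; first by rewrite !big_nil.
rewrite !big_cons mule_eq0 negb_or => /andP[g0 /IH e].
rewrite -[LHS]/(g.1 + (\prod_(j <- a) j)%g.1) e /=.
have -> : g.1 = -1.
  apply/eqP; apply: contraNT g0 => g1; rewrite eq_le measure_ge0 andbT.
  rewrite -down_increments; apply: le_measure; rewrite ?inE// => _ -> //.
by lia.
Qed.

Section flip.
Variables (delta : conf) (M : nat).
Hypothesis delta_supp : forall z, delta z != 0 -> (`|z| <= M)%N.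

(** The window of the configuration phi, drawn at the time k, covers the sites
    between -M and M, and therefore delta. *)
Definition long k phi := (M <= k)%N /\ exists2 n, (k + M < n)%N & Kset n phi.

Definition flip k (g : lamp) : lamp :=
  if `[< long k g.2 >] then (g.1, g.2 + shift k%:Z delta) else g.

Let long_flip k phi : long k phi -> long k (phi + shift k%:Z delta).
Proof. by move=> [Mk [n kn Kn]]; split=> //; exists n => //; exact: Kset_flip delta_supp Mk kn Kn. Qed.

Let flipE k g : long k g.2 -> flip k g = (g.1, g.2 + shift k%:Z delta).
Proof. by move=> l; rewrite /flip asboolT. Qed.

Let flip_long k g : long k (flip k g).2 <-> long k g.2.
Proof. by rewrite /flip; case: asboolP => //= l; split => // _; exact: long_flip. Qed.

Lemma flipK k : involutive (flip k).
Proof.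
move=> [x phi]; rewrite {2}/flip; case: asboolP => /= l; last first.
  by rewrite /flip asboolF.
rewrite flipE/=; last exact: long_flip.
by rewrite -addrA conf_addrr addr0.
Qed.

(** K_n is stable under the flip when n is large enough for the flip to act on it,
    and is fixed pointwise otherwise. *)
Lemma flip_mu k g : mu [set flip k g] = mu [set g].
Proof.
rewrite !muE; apply: eq_eseriesr => n _.
have [->|n0] := posnP n; first by rewrite positive_law0// !mul0e.
congr (_ * _)%E; rewrite !nu_kappa//; case: g => x phi.
have [->|x1] := eqVneq x (-1); last first.
  rewrite (_ : [set _ | _] = set0).
    rewrite (_ : [set _ | _] = set0)//.
    by apply/seteqP; split=> // psi /= [e]; rewrite e eqxx in x1.
  apply/seteqP; split=> // psi; rewrite /flip /=; case: asboolP => _ [e];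
  by rewrite -e eqxx in x1.
rewrite (_ : [set _ | [set (-1, phi)] _] = [set phi]); last first.
  by apply/seteqP; split=> [psi /= [->]|psi ->].
rewrite /flip/=; case: asboolP => l; last first.
  rewrite (_ : [set _ | [set (-1, phi)] _] = [set phi])//.
  by apply/seteqP; split=> [psi /= [->]|psi ->].
rewrite (_ : [set _ | _] = [set phi + shift k%:Z delta]); last first.
  by apply/seteqP; split=> [psi /= [->]|psi ->].
apply: kappa_singleton; have [Mk [m kn Km]] := l; split=> K.
  have Km' := Kset_flip delta_supp Mk kn Km.
  by rewrite (Kset_inj K Km').
by rewrite (Kset_inj K Km); exact: Kset_flip delta_supp Mk kn Km.
Qed.

Definition first_long k : set (paths lamp) := [set h |
  [/\ forall i, (i < k)%N -> (h i).1 = -1,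
      forall i, (i < k)%N -> ~ long i (h i).2 & long k (h k).2]].

Definition flip_at k : paths lamp -> paths lamp :=
  coordinatewise (fun i => if i == k then flip k else id).

Let flip_at_ne k h i : i != k -> flip_at k h i = h i.
Proof. by rewrite /flip_at /coordinatewise => /negbTE ->. Qed.

Let flip_at_eq k h : flip_at k h k = flip k (h k).
Proof. by rewrite /flip_at /coordinatewise eqxx. Qed.

Let measurable_first_long k : measurable (first_long k).
Proof.
apply: (@measurable_finite_dep _ k.+1) => h h' e [h1 h2 h3].
have eh i : (i < k.+1)%N -> h i = h' i.
  by move=> ik; rewrite -(nth_mkseq 1%g h ik) e nth_mkseq.
by split=> [i ik|i ik|]; rewrite -eh ?ltnS ?(ltnW ik)//; [exact: h1|exact: h2].
Qed.

Let first_long_flip k h : first_long k (flip_at k h) <-> first_long k h.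
Proof.
rewrite /first_long /= flip_at_eq.
have e i : (i < k)%N -> flip_at k h i = h i by move=> ik; rewrite flip_at_ne// ltn_eqF.
split=> -[h1 h2 /flip_long h3]; (split=> [i ik|i ik|//]; [move: (h1 _ ik)|move: (h2 _ ik)]);
  by rewrite e.
Qed.

(** For i at least M, the increment at the time i is long as soon as it is drawn
    from K_n with n > i + M, and the sum over i of these probabilities is infinite
    by the first moment. *)
Lemma first_long_total (Q : probability (paths lamp) R) : iid_law mu Q ->
  Q (~` \bigcup_k first_long k) = 0%E.
Proof.
move=> iid.
pose U : set (paths lamp) := [set h | forall i, ~ long i (h i).2].
pose D i : set (paths lamp) := [set h | (h i).1 != -1].
have QD i : Q (D i) = 0%E.
  by rewrite -down_increments -(iid_coord iid i).
have QU : Q U = 0%E.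
  have := @iid_never_hit R lamp mu Q (fun i => [set g | long i g.2]) iid; apply.
  apply/eqP; rewrite -leye_eq -(@tail_sum_late _ alpha (M + M) moment).
  rewrite [leRHS](nneseries_split 0 M)// add0n.
  rewrite -(@nneseries_addn _ (fun i => mu [set g | long i g.2]))//.
  apply: (@le_trans _ _ (\sum_(0 <= i <oo) mu [set g | long (i + M) g.2])%E); last first.
    by rewrite leeDr// sume_ge0.
  apply: lee_nneseries => // j _; rewrite muE law_nat_sum.
  apply: lee_nneseries => [i _ _|n _]; first by case: ifP.
  case: ifPn => [/set_mem/= jn|_]; last by apply: mule_ge0.
  have n0 : (0 < n)%N by exact: leq_ltn_trans jn.
  rewrite -[leLHS]mule1 lee_wpmul2l// -(nu_Kset n0).
  apply: le_measure; rewrite ?inE// => phi Kphi; split=> /=.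
    exact: leq_addl.
  by exists n => //; rewrite -addnA.
have sub : ~` (\bigcup_k first_long k) `<=` U `|` \bigcup_i D i.
  move=> h nh; have [Uh|] := pselect (U h); first by left.
  move=> /existsNP[i0 /contrapT li]; right; apply: contrapT => nD.
  have exl : exists i, `[< long i (h i).2 >] by exists i0; exact/asboolP.
  case: (ex_minnP exl) => k /asboolP lk kmin; apply: nh; exists k => //; split=> //.
    move=> i _; apply/eqP; apply: contrapT => hi; apply: nD; exists i => //.
    exact/negP.
  by move=> i ik /asboolP /kmin; rewrite leqNgt ik.
have mU : measurable U.
  rewrite (_ : U = \bigcap_i [set h : paths lamp | [set g : lamp | ~ long i g.2] (h i)]).
    by apply: bigcap_measurableType => i _; exact: measurable_coord.
  by apply/seteqP; split=> [h Nh i _|h Nh i]; [exact: Nh|exact: (Nh i I)].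
have mD i : measurable (D i).
  exact: (@measurable_coord _ i [set g : lamp | g.1 != -1]).
apply: measure_negligible; first by apply: measurableC; exact: bigcupT_measurable.
apply: (negligibleS sub); apply: negligibleU; first by apply/negligibleP.
by apply: negligible_bigcup => i; apply/negligibleP; [exact: mD|exact: QD].
Qed.

(** At the time k the walker is at -k, which undoes the shift by k in the flip, so
    exactly delta is added to the lamps. *)
Lemma walk_flip_at k h t : first_long k h -> (k < t)%N ->
  walk (flip_at k h) t = ((walk h t).1, (walk h t).2 + delta).
Proof.
move=> [down _ lk].
have pre n : (n <= k)%N -> walk (flip_at k h) n = walk h n.
  elim: n => [|n IH] nk; first by rewrite /walk !big_ord0.
  by rewrite !walkS IH ?(ltnW nk)// flip_at_ne// ltn_eqF.
have pos n : (n <= k)%N -> (walk h n).1 = - n%:Z.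
  elim: n => [|n IH] nk; first by rewrite /walk big_ord0.
  rewrite walkS -[LHS]/((walk h n).1 + (h n).1) IH ?(ltnW nk)// down//.
  by lia.
elim: t => // t IH; rewrite ltnS leq_eqVlt => /orP[/eqP <-|kt].
  rewrite !walkS pre// flip_at_eq flipE//.
  rewrite -[LHS]/((walk h k).1 + (h k).1,
    (walk h k).2 + shift (walk h k).1 ((h k).2 + shift k%:Z delta)).
  rewrite -[RHS]/((walk h k).1 + (h k).1,
    (walk h k).2 + shift (walk h k).1 (h k).2 + delta).
  by rewrite shiftD shift_shift pos// addNr shift_id addrA.
rewrite !walkS IH// flip_at_ne ?gtn_eqF//.
rewrite -[LHS]/((walk h t).1 + (h t).1,
  (walk h t).2 + delta + shift (walk h t).1 (h t).2).
rewrite -[RHS]/((walk h t).1 + (h t).1,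
  (walk h t).2 + shift (walk h t).1 (h t).2 + delta).
by rewrite addrAC.
Qed.

(** The two walks agree after the first long increment, and the event A does not
    see what happens before. *)
Lemma hit_flip (Q : probability (paths lamp) R) (A : set (paths lamp)) (x : int) phi :
  iid_law mu Q -> measurable A -> time_shift @^-1` A = A ->
  Q (hit ((x, phi + shift x delta) : lamp) A) = Q (hit ((x, phi) : lamp) A).
Proof.
move=> iid mA invA.
apply: (@eq_probability_swaps _ _ _ _ first_long flip_at); rewrite ?first_long_total//.
- exact: measurable_hit.
- exact: measurable_hit.
- move=> i j h [_ ni li] [_ nj lj].
  by have [ij|ji|//] := ltngtP i j; [case: (nj i ij)|case: (ni j ji)].
- move=> k B mB; apply: (iid_involution iid) => // [t|t g]; case: eqP => // _.
    exact: flipK.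
  exact: flip_mu.
move=> k h Eh; rewrite /hit /= -(shift_invariant_drop k.+1 _ invA).
rewrite -[X in _ <-> X](shift_invariant_drop k.+1 _ invA).
suff -> : drop_path k.+1 (translate ((x, phi + shift x delta) : lamp) (walk h)) =
  drop_path k.+1 (translate ((x, phi) : lamp) (walk (flip_at k h))) by [].
apply/funext => t; rewrite /drop_path /translate walk_flip_at// ?leq_addr//.
set w := walk h _.
rewrite -[LHS]/(x + w.1, phi + shift x delta + shift x w.2).
rewrite -[RHS]/(x + w.1, phi + shift x (w.2 + delta)).
by rewrite shiftD addrA addrAC.
Qed.

End flip.

Lemma lamp_liouville : liouville mu.
Proof.
apply: liouville_criterion => Q A a b iid mA invA sab /word_prod_down a1 /word_prod_down b1.
move: a1 b1; rewrite -sab; case: (word_prod a) (word_prod b) => x phi [y psi] /= -> ->.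
set n : int := - _; pose delta := shift (- n) (phi - psi).
have [M suppM] := conf_bounded delta.
have -> : phi = psi + shift n delta.
  by rewrite /delta shift_shift subrr shift_id addrC subrK.
exact: (hit_flip suppM).
Qed.

End lamplighter.

(** * The joint walk *)

Definition differ (z : int) : set (discr lamp2) := [set g : lamp2 | g.2.1 z != g.2.2 z].

(** The first increment acts at the position 0, so it compares the two walks at the
    site m with its own lamps at m, while the increment i compares them there with
    its own lamps at m + i, where the two coordinates agree.  From the time 1 on,
    whether the walks agree at m is therefore decided by the first increment. *)
Lemma nonliouville_criterion (R : realType) (mu : probability (discr lamp2) R) (m : nat) :
  mu [set g : lamp2 | g.1 != -1] = 0%E -> (forall z, (m < z)%N -> mu (differ z%:Z) = 0%E) ->
  (0 < mu (differ m%:Z))%E -> (0 < mu (~` differ m%:Z))%E -> ~ liouville mu.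
Proof.
move=> down above pos neg L; have [Q iid] := iid_exists mu.
pose ag (g : lamp2) := g.2.1 m%:Z == g.2.2 m%:Z.
pose A : set (paths lamp2) := [set w | exists T, forall t, (T <= t)%N -> ag (w t)].
have mA : measurable A.
  rewrite (_ : A = \bigcup_T \bigcap_t [set w : paths lamp2 | [set g | (T <= t)%N -> ag g] (w t)]).
    apply: bigcupT_measurable => T; apply: bigcap_measurableType => t _.
    exact: measurable_coord.
  apply/seteqP; split=> [w [T wT]|w [T _ wT]]; first by exists T => // t _; exact: wT.
  by exists T => t; exact: wT.
have invA : time_shift @^-1` A = A.
  apply/seteqP; split=> w [T wT]; last by exists T => t Tt; apply: wT; exact: leqW.
  by exists T.+1 => -[//|t] Tt; exact: wT.
pose N : set (paths lamp2) := \bigcup_i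
  ([set h | (h i).1 != -1] `|` [set h | differ (m + i.+1)%N%:Z (h i.+1)]).
have nullN : Q.-negligible N.
  apply: negligible_bigcup => i; apply: negligibleU; apply/negligibleP.
  - exact: (@measurable_coord _ i [set g : lamp2 | g.1 != -1]).
  - by rewrite -down -(iid_coord iid i).
  - exact: measurable_coord.
  - rewrite -(above (m + i.+1)%N); first exact: (iid_coord iid i.+1).
    by rewrite -addSnnS leq_addr.
have agE h t : ~ N h -> ag (walk h t.+1) = ag (h 0%N).
  move=> nN; have d i : (h i).1 = -1.
    by apply/eqP; apply: contrapT => /negP hi; apply: nN; exists i => //; left.
  have e i : (h i.+1).2.1 (m + i.+1)%N%:Z = (h i.+1).2.2 (m + i.+1)%N%:Z.
    by apply/eqP; apply: contrapT => /negP hi; apply: nN; exists i => //; right.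
  have pos_walk n : (walk h n).1 = - n%:Z.
    elim: n => [|n IH]; first by rewrite /walk big_ord0.
    by rewrite walkS -[LHS]/((walk h n).1 + (h n).1) IH d; lia.
  elim: t => [|t IH]; first by rewrite walkS {1}/walk big_ord0 mul1g.
  rewrite -IH walkS; set w := walk h t.+1.
  rewrite /ag -[X in X == _]/((w.2.1 + Defs.shift w.1 (h t.+1).2.1) m%:Z).
  rewrite -[X in _ == X]/((w.2.2 + Defs.shift w.1 (h t.+1).2.2) m%:Z).
  rewrite !confD !shiftE pos_walk opprK -PoszD e.
  exact: (inj_eq (addIr _)).
have mh0 (B : set lamp2) : measurable [set h : paths lamp2 | B (h 0%N)].
  exact: measurable_coord.
have mWA : measurable (walk @^-1` A).
  by rewrite -[X in measurable X]setTI; exact: measurable_walk.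
have [QA|QA] := liouville_zero_one L iid mA invA.
  suff : Q [set h | (~` differ m%:Z) (h 0%N)] = 0%E.
    by rewrite (iid_coord iid) => z; rewrite z ltxx in neg.
  apply: measure_negligible; first exact: mh0.
  apply: (@negligibleS _ _ _ _ (walk @^-1` A `|` N)); last first.
    by apply: negligibleU => //; exact/negligibleP.
  move=> h hm; have [|nN] := pselect (N h); [by right|left].
  by exists 1%N => -[//|t] _; rewrite agE//; apply/negPn/negP.
suff : Q [set h | differ m%:Z (h 0%N)] = 0%E.
  by rewrite (iid_coord iid) => z; rewrite z ltxx in pos.
apply: measure_negligible; first exact: mh0.
apply: (@negligibleS _ _ _ _ (~` (walk @^-1` A) `|` N)); last first.
  apply: negligibleU => //; apply/negligibleP; first exact: measurableC.
  transitivity (1 - Q (walk @^-1` A))%E; first exact: probability_setC.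
  by rewrite QA subee.
move=> h hm; have [|nN] := pselect (N h); [by right|left].
by move=> [T /(_ T.+1 (leqnSn T))]; rewrite agE//; apply/negP.
Qed.

Section nondiagonal.
Context {R : realType}.
Variables (alpha : probability nat R)
  (kappat : nat -> probability (discr (conf * conf)%type) R).
Hypothesis alpha_pos : alpha [set n | (0 < n)%N] = 1%E.
Hypothesis kappat_supp : forall n, (0 < n)%N -> kappat n (Kset n `*` Kset n) = 1%E.
Hypothesis kappat_fst : forall n, (0 < n)%N -> image_law fst (kappat n) =1 kappa n.
Hypothesis moment : (\sum_(1 <= n <oo) n%:R%:E * alpha [set n])%E = +oo%E.

Definition nondiag : set nat := [set n | [/\ (0 < n)%N, (0 < alpha [set n])%E &
  ~ (kappat n =1 @diag_kappa R n)]].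

Let offdiag : set (discr (conf * conf)%type) := [set p : conf * conf | p.1 <> p.2].

Let mut : probability (discr lamp2) R := down_law (mixture alpha kappat).

Let mutE B : mut B =
  (\sum_(0 <= n <oo) alpha [set n] * kappat n [set p | B ((-1)%R, p)])%E.
Proof. by []. Qed.

Lemma diag_offdiag n : kappat n =1 diag_kappa n -> kappat n offdiag = 0%E.
Proof.
move=> ->; rewrite /diag_kappa /pushforward (_ : _ @^-1` _ = set0).
  by rewrite /kappa /unif setI0 fset_set0 cardfs0 mul0r.
by apply/seteqP; split.
Qed.

(** A coupling carried by the diagonal is determined by its first marginal, so the
    uniform marginal makes it the diagonal coupling. *)
Lemma offdiag_gt0 n : (0 < n)%N -> ~ (kappat n =1 @diag_kappa R n) ->
  (0 < kappat n offdiag)%E.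
Proof.
move=> n0 nd; rewrite lt0e measure_ge0 andbT; apply/eqP => off0; apply: nd => B.
rewrite -[RHS](kappat_fst n0).
have cut X : kappat n X = kappat n (X `&` ~` offdiag).
  rewrite (measureDI (kappat n) (A := X) (B := offdiag))//.
  rewrite -setDE -[RHS]adde0; congr (_ + _)%E.
  apply/eqP; rewrite eq_le measure_ge0 andbT -off0.
  by apply: le_measure; rewrite ?inE//; exact: subIsetr.
rewrite cut [RHS]cut; congr (kappat n _).
apply/seteqP; split=> -[p q] [] /=; rewrite /discr_fun /preimage /= /offdiag/= =>
  + /contrapT e; rewrite e; split => //; by apply.
Qed.

Lemma mut_term n B : (alpha [set n] * kappat n [set p | B ((-1)%R, p)] <= mut B)%E.
Proof.
rewrite mutE; apply: le_trans (nneseries_lim_ge n.+1 _); last first.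
  by move=> k _ _; apply: mule_ge0.
by rewrite big_nat_recr//= leeDr// sume_ge0// => k _; apply: mule_ge0.
Qed.

(** The site m of the criterion is the largest one at which the coordinates of an
    increment differ with positive probability.  It exists since they differ only
    at sites of [0, N], N being a bound on the non-diagonal indices. *)
Lemma mut_nonliouville : nondiag !=set0 -> finite_set nondiag -> ~ liouville mut.
Proof.
move=> [n1 n1nd] fin.
have [N ndN] : exists N, forall n, nondiag n -> (n <= N)%N.
  exists (\max_(n <- fset_set nondiag) n) => n nn.
  by apply: (@leq_bigmax_seq _ _ xpredT id) => //; rewrite in_fset_set// inE.
have diagN n : (0 < n)%N -> (0 < alpha [set n])%E -> ~ nondiag n -> kappat n offdiag = 0%E.
  move=> n0 an nn; apply: diag_offdiag; apply: contrapT => nd; exact: nn.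
have supp n (B : set (discr (conf * conf)%type)) : (0 < n)%N ->
    B `<=` ~` (Kset n `*` Kset n) -> kappat n B = 0%E.
  move=> n0 BK; apply/eqP; rewrite eq_le measure_ge0 andbT.
  have <- : kappat n (~` (Kset n `*` Kset n)) = 0%E.
    by rewrite probability_setC// kappat_supp// subee.
  by apply: le_measure; rewrite ?inE.
have above z : (N < z)%N -> mut (differ z%:Z) = 0%E.
  move=> Nz; rewrite mutE eseries0// => n _ _.
  have [->|n0] := posnP n.
    by rewrite positive_law0// mul0e.
  have [->|an0] := eqVneq (alpha [set n]) 0%E; first by rewrite mul0e.
  have an : (0 < alpha [set n])%E by rewrite lt0e an0 measure_ge0.
  have [nn|nn] := pselect (nondiag n).
    rewrite supp ?mule0// => -[p q] /= dz [[/= Kp _] [Kq _]].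
    move: dz; rewrite /differ/=; have nz : ~~ (0 <= z%:Z <= n%:Z).
      by rewrite negb_and; apply/orP; right; have := ndN _ nn; lia.
    have -> : p z%:Z = 0 by apply/eqP; apply: contraNT nz; exact: Kp.
    have -> : q z%:Z = 0 by apply/eqP; apply: contraNT nz; exact: Kq.
    by rewrite eqxx.
  rewrite (_ : kappat n _ = 0%E) ?mule0//; apply/eqP.
  rewrite eq_le measure_ge0 andbT -(diagN n n0 an nn).
  by apply: le_measure; rewrite ?inE// => -[p q] /= /eqP pq e; apply: pq; rewrite [p]e.
have [d dpos] : exists d : nat, (0 < mut (differ d%:Z))%E.
  apply: contrapT => /forallNP none; have [n10 a1 /(offdiag_gt0 n10)] := n1nd.
  apply/negP; rewrite -leNgt measure_le0; apply/eqP.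
  apply: measure_negligible => //.
  pose U : set (discr (conf * conf)%type) := ~` (Kset n1 `*` Kset n1).
  pose D z : set (discr (conf * conf)%type) := [set p : conf * conf | p.1 z%:Z != p.2 z%:Z].
  apply: (@negligibleS _ _ _ _ (U `|` \bigcup_z D z)).
    move=> -[p q] /= pq; have [[[/= Kp _] [/= Kq _]]|] := pselect ((Kset n1 `*` Kset n1) (p, q));
      last by left.
    right; apply: contrapT => nz; apply: pq; apply/confP => z.
    apply: contrapT => /eqP pqz; apply: nz.
    have z0 : 0 <= z.
      have [p0|/Kp/andP[]//] := eqVneq (p z) 0; have [q0|/Kq/andP[]//] := eqVneq (q z) 0.
      by rewrite p0 q0 eqxx in pqz.
    by exists `|z|%N => //; rewrite /D/= gez0_abs.
  apply: negligibleU; first by apply/negligibleP => //; exact: supp.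
  apply: negligible_bigcup => z; apply/negligibleP => //.
  have := none z; move/negP; rewrite -leNgt => le0.
  have := le_trans (mut_term n1 (differ z%:Z)) le0.
  rewrite pmule_rle0// measure_le0 => /eqP; exact.
have bounded z : (0 < mut (differ z%:Z))%E -> (z <= N)%N.
  by move=> mz; rewrite leqNgt; apply/negP => /above z0; rewrite z0 ltxx in mz.
have exm : exists z : nat, (0 < mut (differ z%:Z))%E by exists d.
case: (ex_maxnP exm bounded) => m mpos mmax.
(* An integer of positive mass beyond N, where the coupling is diagonal. *)
have [n [n0 nn an]] : exists n, [/\ (0 < n)%N, ~ nondiag n & (0 < alpha [set n])%E].
  apply: contrapT => /forallNP none.
  move: moment; rewrite (nneseries_split 1 N); last by move=> k _; apply: mule_ge0.
  rewrite [X in _ + X]eseries0 ?adde0 => [|k Nk _].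
    move/eqP; apply/negP; rewrite -ltey; apply: lte_sum_pinfty => k _.
    by rewrite ltey_eq fin_numM// fin_num_measure.
  have k0 : (0 < k)%N by rewrite (leq_trans _ Nk).
  have [->|ak] := eqVneq (alpha [set k]) 0%E; first by rewrite mule0.
  exfalso; apply: (none k); split=> //; last by rewrite lt0e ak measure_ge0.
  by move=> /ndN; rewrite leqNgt Nk.
apply: (@nonliouville_criterion _ _ m) => //.
- rewrite mutE eseries0// => k _ _.
  rewrite (_ : [set p | _] = set0) ?measure0 ?mule0//.
  by apply/seteqP; split=> // p /=; rewrite eqxx.
- move=> z mz; apply/eqP; rewrite -measure_le0 leNgt; apply/negP => /mmax.
  by rewrite leqNgt mz.
apply: lt_le_trans (mut_term n _); apply: mule_gt0 => //.
rewrite (@lt_le_trans _ _ (kappat n (~` offdiag)))//.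
  by rewrite probability_setC// diagN// sube0 lte01.
apply: le_measure; rewrite ?inE// => -[p q] /contrapT /= pq /=.
by rewrite /differ /= pq eqxx.
Qed.

End nondiagonal.

(** * Conclusion *)

Theorem theorem54 (R : realType) (alpha : probability nat R)
  (alpha_pos : alpha [set n | (0 < n)%N] = 1%E)
  (kappat : nat -> probability (discr (conf * conf)%type) R)
  (kappat_supp : forall n, (0 < n)%N -> kappat n (Kset n `*` Kset n) = 1%E)
  (kappat_fst : forall n, (0 < n)%N -> image_law fst (kappat n) =1 kappa n)
  (kappat_snd : forall n, (0 < n)%N -> image_law snd (kappat n) =1 kappa n)
  (moment : (\sum_(1 <= n <oo) n%:R%:E * alpha [set n])%E = +oo%E)
  (nondiag_nonempty :
    [set n | [/\ (0 < n)%N, (0 < alpha [set n])%E &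
                 ~ (kappat n =1 diag_kappa n)]] !=set0)
  (nondiag_finite :
    finite_set [set n | [/\ (0 < n)%N, (0 < alpha [set n])%E &
                            ~ (kappat n =1 diag_kappa n)]]) :
  let mut : probability (discr lamp2) R := down_law (mixture alpha kappat) in
  [/\ ~ liouville mut,
      liouville (image_law lamp2_fst mut) &
      liouville (image_law lamp2_snd mut)].
Proof.
move=> mut.
have marginal_Kset (p : conf * conf -> conf) n :
    (forall q, (Kset n `*` Kset n) q -> Kset n (p q)) -> (0 < n)%N ->
    image_law p (kappat n) (Kset n) = 1%E.
  move=> pK n0; apply/eqP; rewrite eq_le probability_le1//= -(kappat_supp n n0).
  by apply: le_measure; rewrite ?inE.
split; first exact: mut_nonliouville.
- apply: (@lamp_liouville _ alpha (fun n => image_law fst (kappat n))) => // n.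
  by apply: marginal_Kset => q [].
- apply: (@lamp_liouville _ alpha (fun n => image_law snd (kappat n))) => // n.
  by apply: marginal_Kset => q [].
Qed.
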